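(* Let $G=(V,E)$ be a simple undirected graph and let $S=\{h\}\cup I\subseteq V$, with $h\notin I$ and $|I|\ge 2$, be a subset of vertices inducing a star graph in $G$ with hub $h$ and set of leaves $I$. Then the inequality $$\sum_{i\in I}x_i+(|I|-1)x_h\le |I|$$ is valid for $\mathscr{P}_{IUC}(G)$. Furthermore, (i) it induces a facet of $\mathscr{P}_{IUC}(G[S])$, and (ii) it is facet-defining for $\mathscr{P}_{IUC}(G)$ if and only if there does not exist a vertex $v\in V\setminus N[h]$ such that $S'=\{v\}\cup I$ induces another star graph in $G$ (with hub $v$ and set of leaves $I$).
   Context: All graphs are finite, simple and undirected; $N(h)$ is the set of vertices adjacent to $h$ and $N[h]=N(h)\cup\{h\}$. A subset $U\subseteq V$ of the vertices of $G=(V,E)$ is an independent union of cliques (IUC) if every connected component of the induced subgraph $G[U]$ is a complete graph (equivalently, $G[U]$ has no induced path on three vertices). The IUC polytope $\mathscr{P}_{IUC}(G)\subseteq\mathbb{R}^{V}$ is the convex hull of the incidence vectors of all IUCs of $G$. A set $\{h\}\cup I$ induces a star graph with hub $h$ and leaves $I$ if $h$ is adjacent to every vertex of $I$ and $I$ is an independent set. *)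

(* Defs.v *)
(* A finite simple undirected graph on the vertex set V is a
   symmetric irreflexive relation e on the finType V. *)
From mathcomp Require Import all_boot all_order all_algebra.

Set Implicit Arguments.
Unset Strict Implicit.
Unset Printing Implicit Defensive.

Import Order.TTheory GRing.Theory Num.Theory.
Local Open Scope ring_scope.

Section Graphs.
Variables (V : finType) (e : rel V).

Definition closed_nbhd (h : V) : {set V} := h |: [set v | e h v].

Definition independent (A : {set V}) : Prop := {in A &, forall x y, ~~ e x y}.

Definition clique (A : {set V}) : bool :=
  [forall x in A, forall y in A, (x != y) ==> e x y].

(* G[U] is a graph on the subtype of the vertices lying in U. *)
Definition induced (U : {set V}) : rel {v : V | v \in U} :=
  [rel x y | e (val x) (val y)].

Definition induces_star (h : V) (I : {set V}) : Prop :=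
  {in I, forall i, e h i} /\ independent I.

End Graphs.

Arguments induced {V} e U.

Definition component (V : finType) (e : rel V) (x : V) : {set V} :=
  [set y | connect e x y].

Definition IUC (V : finType) (e : rel V) (U : {set V}) : bool :=
  [forall x, clique (induced e U) (component (induced e U) x)].

Section Polyhedra.
Variables (R : realFieldType) (V : finType).
Local Notation point := {ffun V -> R}.

Definition incidence (U : {set V}) : point := [ffun v => (v \in U)%:R].

Definition conv_hull (A : point -> Prop) (x : point) : Prop :=
  exists (n : nat) (p : 'I_n -> point) (l : 'I_n -> R),
    [/\ forall i, A (p i), forall i, 0 <= l i,
        \sum_i l i = 1 & x = [ffun v => \sum_i l i * p i v]].

Definition affinely_independent (n : nat) (p : 'I_n -> point) : Prop :=
  forall l : 'I_n -> R,
    \sum_i l i = 0 -> (forall v, \sum_i l i * p i v = 0) -> forall i, l i = 0.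

(* One less than the maximum number of affinely independent points of A; in
   particular the empty set has dimension -1. *)
Definition has_dim (A : point -> Prop) (d : int) : Prop :=
  exists k : nat,
    [/\ d = k%:Z - 1,
        exists p : 'I_k -> point,
          affinely_independent p /\ (forall i, A (p i))
      & forall (m : nat) (p : 'I_m -> point),
          affinely_independent p -> (forall i, A (p i)) -> (m <= k)%N].

(* An inequality \sum_v a_v x_v <= b is given by a : V -> R and b : R. *)
Definition lin_form (a : V -> R) (x : point) : R := \sum_v a v * x v.

Definition valid_ineq (P : point -> Prop) (a : V -> R) (b : R) : Prop :=
  forall x, P x -> lin_form a x <= b.

Definition face (P : point -> Prop) (a : V -> R) (b : R) (x : point) : Prop :=
  P x /\ lin_form a x = b.

Definition facet_defining (P : point -> Prop) (a : V -> R) (b : R) : Prop :=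
  valid_ineq P a b /\
  exists d : int, has_dim P d /\ has_dim (face P a b) (d - 1).

Definition IUC_polytope (e : rel V) : point -> Prop :=
  conv_hull (fun x => exists2 U : {set V}, IUC e U & x = incidence U).

Definition star_coef (h : V) (I : {set V}) (v : V) : R :=
  if v == h then #|I|%:R - 1 else (v \in I)%:R.

Lemma lin_form_star (h : V) (I : {set V}) (x : point) : h \notin I ->
  lin_form (star_coef h I) x = \sum_(i in I) x i + (#|I|%:R - 1) * x h.
Proof.
move=> hI; rewrite /lin_form (bigD1 h) //= /star_coef eqxx addrC; congr (_ + _).
rewrite [RHS]big_mkcond [RHS](bigD1 h) //= (negbTE hI) add0r.
by apply: eq_bigr => v /negbTE ->; case: (v \in I); rewrite ?mul1r ?mul0r.
Qed.

End Polyhedra.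

(* Main.v *)
(* The tight IUCs U are those with U :&: S = I or U :&: S = {h, i}, i in I.
   A vertex v outside S lies in a tight IUC contained in v |: S unless v is not
   adjacent to h but adjacent to all of I: if v is adjacent to h, take
   {h, i, v} or v |: I according to whether v has a neighbour i in I; otherwise
   take {h, i, v} for a non-neighbour i of v.  These sets, together with I and
   the {h, i}, give #|V| affinely independent points of the face, and the face
   misses the origin.  For an exceptional v the stronger inequality obtained by
   adding x_v to the left-hand side is valid, so x_v vanishes on the face, and
   adjoining the origin and then the unit vector of v to affinely independent
   points of the face shows that its codimension is at least 2. *)
Require Import Defs.
From mathcomp Require Import all_boot all_order all_algebra.
Import Order.TTheory GRing.Theory Num.Theory.
Local Open Scope ring_scope.

Set Implicit Arguments.
Unset Strict Implicit.
Unset Printing Implicit Defensive.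

(** * IUCs as vertex sets inducing no path on three vertices *)

Section IndependentUnionsOfCliques.
Variables (V : finType) (e : rel V).
Hypothesis e_sym : symmetric e.

(** Both [x] and [z] lie in the component of [y] in [induced e U], and that component is a
    clique. *)
Lemma IUC_trans (U : {set V}) x y z : IUC e U ->
  x \in U -> y \in U -> z \in U -> e x y -> e y z -> x != z -> e x z.
Proof.
move=> /forallP iucU xU yU zU exy eyz xz.
pose u w (wU : w \in U) : {v : V | v \in U} := exist _ w wU.
have cyx : connect (induced e U) (u y yU) (u x xU) by apply: connect1; rewrite /induced /= e_sym.
have cyz : connect (induced e U) (u y yU) (u z zU) by apply: connect1.
have /forallP/(_ (u x xU)) := iucU (u y yU).
rewrite inE cyx => /forallP/(_ (u z zU)).
by rewrite inE cyz -val_eqE /= xz.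
Qed.

Lemma IUCP (U : {set V}) :
  {in U & &, forall x y z, e x y -> e y z -> x != z -> e x z} -> IUC e U.
Proof.
move=> trU.
(* Every walk can be shortcut edge by edge from its start, so each component consists of a vertex
   and some of its neighbours. *)
have conU x y : connect (induced e U) x y -> x = y \/ e (val x) (val y).
  case/connectP=> p; elim/last_ind: p y => [|p z IHp] y /=; first by left.
  rewrite rcons_path last_rcons => /andP[/IHp/(_ erefl) + exy ->].
  have [->|/[swap]] := eqVneq x z; first by left.
  case=> [-> _|exl xz]; right => //.
  by apply: (trU _ (val (last x p))) => //; apply: valP.
apply/forallP=> x; apply/forallP=> y; apply/implyP; rewrite inE => /conU cxy.
apply/forallP=> z; apply/implyP; rewrite inE => /conU cxz.
apply/implyP=> yz /=; case: cxy yz => [<-|exy]; case: cxz => [<-|exz] yz //.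
- by rewrite eqxx in yz.
- by rewrite /induced /= e_sym.
- by apply: (trU _ _ _ (valP y) (valP x) (valP z)) => //; rewrite e_sym.
Qed.

Lemma independent_IUC (U : {set V}) : independent e U -> IUC e U.
Proof.
by move=> indU; apply: IUCP => x y z xU yU _; rewrite (negbTE (indU x y xU yU)).
Qed.

Lemma edge_IUC x y : IUC e [set x; y].
Proof.
apply: IUCP => a b c; rewrite !inE.
by move=> /orP[]/eqP-> /orP[]/eqP-> /orP[]/eqP->; rewrite ?eqxx // => *; rewrite e_sym.
Qed.

Lemma triangle_IUC x y z : e x y -> e x z -> e y z -> IUC e [set x; y; z].
Proof.
move=> exy exz eyz; apply: IUCP => a b c; rewrite !inE -!orbA.
by move=> /or3P[]/eqP-> _ /or3P[]/eqP->; rewrite ?eqxx // => *; rewrite e_sym.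
Qed.

Lemma edge_vertex_IUC x y z : ~~ e x z -> ~~ e y z -> IUC e [set x; y; z].
Proof.
move=> /negbTE nxz /negbTE nyz; apply: IUCP => a b c; rewrite !inE -!orbA.
have nzx : e z x = false by rewrite e_sym.
have nzy : e z y = false by rewrite e_sym.
by move=> /or3P[]/eqP-> /or3P[]/eqP-> /or3P[]/eqP->;
  rewrite ?eqxx ?nxz ?nyz ?nzx ?nzy // => *; rewrite e_sym.
Qed.

End IndependentUnionsOfCliques.

(** * Linear forms, convex hulls and affine independence *)

Section AffineIndependence.
Variables (R : realFieldType) (V : finType).
Local Notation point := {ffun V -> R}.
Implicit Types (A P : point -> Prop) (a : V -> R) (b : R).

Lemma lin_form_comb a n (p : 'I_n -> point) (l : 'I_n -> R) :
  lin_form a [ffun v => \sum_i l i * p i v] = \sum_i l i * lin_form a (p i).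
Proof.
rewrite /lin_form; under eq_bigr do rewrite ffunE mulr_sumr.
rewrite exchange_big /=; apply: eq_bigr => i _.
by rewrite mulr_sumr; apply: eq_bigr => v _; rewrite mulrCA.
Qed.

Lemma eq_lin_form a a' : a =1 a' -> @lin_form R V a =1 lin_form a'.
Proof. by move=> eqa x; apply: eq_bigr => v _; rewrite eqa. Qed.

Lemma lin_form_incidence0 a : lin_form a (incidence R set0) = 0.
Proof. by rewrite /lin_form big1 // => v _; rewrite ffunE inE mulr0. Qed.

Lemma lin_form_coord v (x : point) : lin_form (fun u => (u == v)%:R) x = x v.
Proof.
rewrite /lin_form (bigD1 v) //= eqxx mul1r big1 ?addr0 // => u /negbTE->.
by rewrite mul0r.
Qed.

Lemma sub_conv_hull A x : A x -> conv_hull A x.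
Proof.
move=> Ax; exists 1%N, (fun=> x), (fun=> 1).
by split=> //; rewrite ?big_ord1 //; apply/ffunP=> v; rewrite ffunE big_ord1 mul1r.
Qed.

Lemma valid_conv_hull A a b : valid_ineq A a b -> valid_ineq (conv_hull A) a b.
Proof.
move=> vA _ [n [p [l [Ap l0 l1 ->]]]]; rewrite lin_form_comb.
by rewrite -[b]mul1r -l1 mulr_suml ler_sum // => i _; rewrite ler_wpM2l ?vA.
Qed.

(** Applying the form [a] to a vanishing combination whose weights sum to 0 leaves the weight of [q]
    times [lin_form a q - b]. Hence that weight is 0, and the independence of [p] handles the
    others. *)
Lemma affinely_independentS A a b m (p : 'I_m -> point) q :
    affinely_independent p -> (forall i, A (p i)) -> A q ->
    (forall i, lin_form a (p i) = b) -> lin_form a q != b ->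
  exists p' : 'I_m.+1 -> point, affinely_independent p' /\ forall i, A (p' i).
Proof.
move=> indp Ap Aq ap aq; exists (fun i => oapp p q (unlift ord0 i)); split; last first.
  by move=> i; case: unliftP => [j|] _ /=.
move=> l l0 lp0.
have lq0 : l ord0 = 0.
  have : \sum_i l i * lin_form a (oapp p q (unlift ord0 i)) = 0.
    rewrite -lin_form_comb /lin_form big1 // => v _.
    by rewrite ffunE lp0 mulr0.
  rewrite big_ord_recl unlift_none /=.
  rewrite (eq_bigr (fun i => l (lift ord0 i) * b)); last first.
    by move=> i _; rewrite liftK /= ap.
  rewrite -mulr_suml; move: l0; rewrite big_ord_recl addrC => /eqP.
  rewrite addr_eq0 => /eqP->; rewrite mulNr -mulrBr => /eqP.
  by rewrite mulf_eq0 subr_eq0 (negbTE aq) orbF => /eqP.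
have lp i : l (lift ord0 i) = 0.
  apply: (indp (fun i => l (lift ord0 i))) => [|v].
    by move: l0; rewrite big_ord_recl lq0 add0r.
  move: (lp0 v); rewrite big_ord_recl lq0 mul0r add0r => {2}<-.
  by apply: eq_bigr => j _; rewrite liftK.
by move=> i; case: (unliftP ord0 i) => [j|] ->.
Qed.

(** Prefixing each point with a coordinate 1 turns affine independence into linear independence of
    rows of length [1 + #|V|]. *)
Lemma leq_affinely_independent m (p : 'I_m -> point) :
  affinely_independent p -> (m <= #|V|.+1)%N.
Proof.
move=> indp.
pose M : 'M[R]_(m, 1 + #|V|) :=
  row_mx (const_mx 1) (\matrix_(i, j) p i (enum_val j)).
suff /eqP <- : row_free M by apply: rank_leq_col.
rewrite -kermx_eq0; apply/rowV0P => u /sub_kermxP.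
rewrite mul_mx_row -[0]row_mx0 => /eq_row_mx[/rowP u1 /rowP up].
apply/rowP=> i; rewrite mxE; apply: (indp (u 0)) => [|v].
  move: (u1 0); rewrite !mxE => {2}<-.
  by apply: eq_bigr => j _; rewrite mxE mulr1.
move: (up (enum_rank v)); rewrite !mxE => {2}<-.
by apply: eq_bigr => j _; rewrite mxE enum_rankK.
Qed.

Lemma affinely_independent_finType (q : V -> point) :
    (forall l : V -> R, \sum_u l u = 0 ->
       (forall v, \sum_u l u * q u v = 0) -> forall u, l u = 0) ->
  affinely_independent (fun i : 'I_#|V| => q (enum_val i)).
Proof.
have reindexV (F : V -> R) : \sum_u F u = \sum_(i < #|V|) F (enum_val i).
  by rewrite (reindex _ (onW_bij _ (@enum_val_bij V))).
move=> indq l l0 lq0 i; rewrite -[i]enum_valK.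
apply: (indq (l \o enum_rank)) => [|v]; rewrite reindexV.
  by under eq_bigr do rewrite /= enum_valK.
by under eq_bigr do rewrite /= enum_valK.
Qed.

Lemma eq_has_dim A A' d : (forall x, A x <-> A' x) -> has_dim A d -> has_dim A' d.
Proof.
move=> eqA [k [-> [p [indp Ap]] maxk]]; exists k; split=> //.
  by exists p; split=> // i; apply/eqA.
by move=> m p' indp' Ap'; apply: (maxk m p') => // i; apply/eqA.
Qed.

Lemma eq_facet_defining P a a' b : a =1 a' ->
  facet_defining P a b -> facet_defining P a' b.
Proof.
move=> /eq_lin_form eqa [vP [d [dP dF]]]; split=> [x Px|].
  by rewrite -eqa vP.
exists d; split=> //; apply: eq_has_dim dF => x.
by rewrite /face eqa.
Qed.

End AffineIndependence.

(** * Validity of the star inequality, and the obstruction by a second hub *)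

Section StarInequality.
Variables (R : realFieldType) (V : finType) (e : rel V).
Hypotheses (e_sym : symmetric e) (e_irr : irreflexive e).
Variables (h : V) (I : {set V}).
Hypotheses (hI : h \notin I) (I_ge2 : (2 <= #|I|)%N) (starS : induces_star e h I).

Lemma IUC_in_polytope U : IUC e U -> IUC_polytope e (incidence R U).
Proof. by move=> iucU; apply: sub_conv_hull; exists U. Qed.

Lemma lin_form_star_incidence U :
  lin_form (star_coef R h I) (incidence R U) =
    #|I :&: U|%:R + (#|I|%:R - 1) * (h \in U)%:R.
Proof.
rewrite lin_form_star // ffunE; congr (_ + _).
rewrite -sum1_card natr_sum big_mkcond [RHS]big_mkcond /=.
by apply: eq_bigr => i _; rewrite inE ffunE; case: (i \in I); case: (i \in U).
Qed.

(** Two leaves in [U] would be joined through [v], hence adjacent, against independence. The hub is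
    left arbitrary because the bound serves both [h] and an exceptional vertex. *)
Lemma card_IUC_star v U : induces_star e v I -> IUC e U -> v \in U ->
  (#|I :&: U| <= 1)%N.
Proof.
move=> [adjv indI] iucU vU; apply/card_le1_eqP => i j.
rewrite !inE => /andP[iI iU] /andP[jI jU]; apply/eqP; apply: contraT; rewrite eq_sym => ij.
have eiv : e i v by rewrite e_sym adjv.
by have := indI i j iI jI; rewrite (IUC_trans e_sym iucU iU vU jU eiv (adjv j jI) ij).
Qed.

Lemma star_valid : valid_ineq (IUC_polytope e) (star_coef R h I) #|I|%:R.
Proof.
apply: valid_conv_hull => _ [U iucU ->]; rewrite lin_form_star_incidence.
have [hU|hU] := boolP (h \in U); last first.
  by rewrite mulr0 addr0 ler_nat subset_leq_card // subsetIl.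
by rewrite mulr1 addrC -lerBrDl opprB addrC subrK lern1 (card_IUC_star starS).
Qed.

Lemma star_face_coord0 v : v \notin closed_nbhd e h -> induces_star e v I ->
  forall x, face (IUC_polytope e) (star_coef R h I) #|I|%:R x -> x v = 0.
Proof.
rewrite !inE negb_or => /andP[vh nehv] starv x [Px xI].
(* The strengthened inequality, with [x_v] added to the left-hand side. *)
pose a u : R := star_coef R h I u + (u == v)%:R.
have aE y : lin_form a y = lin_form (star_coef R h I) y + y v.
  rewrite -[y v]lin_form_coord /lin_form -big_split.
  by apply: eq_bigr => u _; rewrite mulrDl.
have valid_a : valid_ineq (IUC_polytope e) a #|I|%:R.
  apply: valid_conv_hull => _ [U iucU ->].
  rewrite aE [X in _ + X]ffunE.
  have [vU|vU] := boolP (v \in U); last first.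
    rewrite addr0; apply: star_valid; exact: IUC_in_polytope.
  rewrite lin_form_star_incidence.
  have [hU|hU] := boolP (h \in U); last first.
    rewrite mulr0 addr0 -natrD ler_nat addn1.
    (* At most one leaf lies in [U] and [v] contributes one more: at most 2 in all, which is at most
       [#|I|]. *)
    exact: leq_ltn_trans (card_IUC_star starv iucU vU) I_ge2.
  (* A leaf in [U] would link the nonadjacent vertices [h] and [v]. Without leaves the left-hand
     side is exactly [#|I| - 1 + 1]. *)
  have -> : I :&: U = set0.
    apply/setP=> i; rewrite !inE; apply/negP=> /andP[iI iU].
    have := IUC_trans e_sym iucU hU iU vU; rewrite (negbTE nehv) eq_sym vh.
    by rewrite starS.1 // e_sym starv.1 // => /(_ isT isT isT).
  by rewrite cards0 add0r mulr1 subrK.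
apply/eqP; rewrite eq_le; apply/andP; split.
  by have := valid_a x Px; rewrite aE xI gerDl.
case: Px => n [p [l [Ap l0 _ ->]]]; rewrite ffunE sumr_ge0 // => i _.
by have [U _ ->] := Ap i; rewrite ffunE mulr_ge0 ?ler0n.
Qed.

Lemma facet_no_other_hub :
  facet_defining (IUC_polytope e) (star_coef R h I) #|I|%:R ->
  ~ (exists v : V, v \notin closed_nbhd e h /\ induces_star e v I).
Proof.
move=> [_ [_ [[k [-> _ maxP]] [m [dm [p [indp Fp]] _]]]]] [v [vh starv]].
(* The facet has [m] affinely independent points and the polytope at most [m.+1]; two further points
   will give a contradiction. *)
have {dm} km : k = m.+1 by move/addIr/eqP: dm; rewrite subr_eq addrC -intS => /eqP[].
rewrite {}km in maxP.
have zeroP : IUC_polytope e (incidence R set0).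
  by apply/IUC_in_polytope/independent_IUC => // x y; rewrite inE.
have unitP : IUC_polytope e (incidence R [set v]).
  apply/IUC_in_polytope/independent_IUC => // x y.
  by rewrite !inE => /eqP-> /eqP->; rewrite e_irr.
(* The origin is adjoined within the slice [x v = 0], so that the coordinate form of [v] then
   separates the unit vector from all earlier points. *)
pose A (x : {ffun V -> R}) := IUC_polytope e x /\ x v = 0.
have FA i : A (p i) by split; [have [] := Fp i | apply: star_face_coord0 (Fp i)].
have [|||p1 [indp1 Ap1]] := affinely_independentS (a := star_coef R h I)
    (b := #|I|%:R) (q := incidence R set0) indp FA _ _ _ => //.
- by split=> //; rewrite ffunE inE.
- by move=> i; have [] := Fp i.
- by rewrite lin_form_incidence0 eq_sym pnatr_eq0 -lt0n ltnW.
have [||||p2 [indp2 Pp2]] := affinely_independentS (A := IUC_polytope e)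
    (a := fun u => (u == v)%:R) (b := 0) (q := incidence R [set v]) indp1 _ _ _ _ => //.
- by move=> i; have [] := Ap1 i.
- by move=> i; rewrite lin_form_coord; have [] := Ap1 i.
- by rewrite lin_form_coord ffunE set11 oner_eq0.
by have := maxP _ p2 indp2 Pp2; rewrite ltnn.
Qed.

(** * Tight IUCs and the facet property in the absence of a second hub *)

Let tight (U : {set V}) : Prop := lin_form (star_coef R h I) (incidence R U) = #|I|%:R.

Lemma tight_leaves (U : {set V}) : h \notin U -> I \subset U -> tight U.
Proof.
move=> /negbTE hU /setIidPl IU.
by rewrite /tight lin_form_star_incidence hU IU mulr0 addr0.
Qed.

Lemma tight_edge i (U : {set V}) : h \in U -> I :&: U = [set i] -> tight U.
Proof.
move=> hU IU.
by rewrite /tight lin_form_star_incidence hU IU cards1 mulr1 addrC subrK.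
Qed.

Lemma leaves_setI_path i v : i \in I -> v \notin I -> I :&: [set h; i; v] = [set i].
Proof.
move=> iI vI; apply/setP=> x; rewrite !inE.
have [->|xi] := eqVneq x i; first by rewrite iI orbT.
have [->|xh] := eqVneq x h; first by rewrite (negbTE hI).
by have [->|] := eqVneq x v; rewrite ?(negbTE vI) ?andbF.
Qed.

Lemma tight_IUC_through v :
    ~ (exists v : V, v \notin closed_nbhd e h /\ induces_star e v I) ->
    v \notin h |: I ->
  exists U : {set V}, [/\ IUC e U, tight U, v \in U & U \subset v |: (h |: I)].
Proof.
move=> nohub; rewrite in_setU1 negb_or => /andP[vh vI].
have [adjh indI] := starS.
have path_sub i : i \in I -> [set h; i; v] \subset v |: (h |: I).
  by move=> iI; apply/subsetP=> x; rewrite !inE -orbA => /or3P[]/eqP->;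
    rewrite ?iI ?eqxx ?orbT.
have path_tight i : i \in I -> tight [set h; i; v].
  by move=> iI; apply: (@tight_edge i); rewrite ?leaves_setI_path // !inE eqxx.
have v_path i : v \in [set h; i; v] by rewrite !inE eqxx !orbT.
have [ehv|nehv] := boolP (e h v).
  have [/existsP[i /andP[iI eiv]]|/existsPn noi] := boolP [exists i, (i \in I) && e i v].
    exists [set h; i; v]; split=> //; [|exact: path_tight|exact: path_sub].
    by apply: triangle_IUC => //; apply: adjh.
  have nvI i : i \in I -> ~~ e i v by move=> iI; have := noi i; rewrite iI.
  exists (v |: I); split; rewrite ?setU11 //; last by rewrite setUS ?subsetUr.
    apply: independent_IUC => // x y; rewrite !inE.
    case/predU1P=> [->|xI]; case/predU1P=> [->|yI]; rewrite ?e_irr ?nvI //.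
      by rewrite e_sym nvI.
    exact: indI.
  apply: tight_leaves; last exact: subsetUr.
  by rewrite in_setU1 negb_or eq_sym vh.
have [/existsP[i /andP[iI neiv]]|/existsPn noi] := boolP [exists i, (i \in I) && ~~ e i v].
  exists [set h; i; v]; split=> //; [|exact: path_tight|exact: path_sub].
  exact: edge_vertex_IUC.
(* Here [v] is not adjacent to [h] but adjacent to every leaf, so it is an excluded second hub. *)
case: nohub; exists v; split; first by rewrite !inE negb_or vh.
by split=> // i iI; have := noi i; rewrite iI negbK e_sym.
Qed.

Lemma no_other_hub_tight_points :
    ~ (exists v : V, v \notin closed_nbhd e h /\ induces_star e v I) ->
  exists p : 'I_#|V| -> {ffun V -> R}, affinely_independent p /\
    forall i, face (IUC_polytope e) (star_coef R h I) #|I|%:R (p i).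
Proof.
move=> nohub; have [adjh indI] := starS.
have exU (u : V) : exists U : {set V}, [/\ IUC e U, tight U &
    if u == h then U = I else if u \in I then U = [set h; u]
    else u \in U /\ U \subset u |: (h |: I)].
  have [_|uh] := eqVneq u h.
    by exists I; split; [apply: independent_IUC | apply: tight_leaves |].
  have [uI|uI] := boolP (u \in I).
    exists [set h; u]; split=> //; first exact: edge_IUC.
    (* The edge is read as the degenerate triple with third vertex [h]. *)
    by apply: (@tight_edge u); rewrite ?setU11 // -[RHS](leaves_setI_path uI hI) setUAC setUid.
  have [|U [iucU tU uU sU]] := tight_IUC_through (v := u) nohub.
    by rewrite in_setU1 negb_or uh.
  by exists U.
have [f fP] := fin_all_exists exU.
exists (fun i => incidence R (f (enum_val i))); split; last first.
  by move=> i; have [iucU tU _] := fP (enum_val i); split=> //; apply: IUC_in_polytope.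
apply: (affinely_independent_finType (q := fun u => incidence R (f u))) => l l0 lf0.
have fh : f h = I by have [_ _] := fP h; rewrite eqxx.
have fI i : i \in I -> f i = [set h; i].
  move=> iI; have [_ _] := fP i; rewrite iI ifN //.
  by apply: contraNneq hI => <-.
(* Among the chosen sets only [f v] contains a vertex [v] outside the star, so coordinate [v]
   isolates [l v]. *)
have out v : v \notin h |: I -> l v = 0.
  move=> vS; move: (lf0 v); rewrite (bigD1 v) //= big1 ?addr0 => [|u uv].
    have [_ _] := fP v; move: vS; rewrite in_setU1 negb_or => /andP[/negbTE-> /negbTE->].
    by case=> vfv _; rewrite ffunE vfv mulr1.
  rewrite ffunE; suff /negbTE-> : v \notin f u by rewrite mulr0.
  move: (vS); rewrite in_setU1 negb_or => /andP[vh vI].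
  have [->|uh] := eqVneq u h; first by rewrite fh.
  have [uI|uI] := boolP (u \in I); first by rewrite fI // !inE negb_or vh eq_sym.
  have [_ _] := fP u; rewrite (negbTE uh) (negbTE uI) => -[_ /subsetP sfu].
  by apply: contra vS => /sfu; rewrite in_setU1 eq_sym (negbTE uv).
(* The hub lies in [f u] for every leaf [u] but not in [f h = I]. Coordinate [h] thus makes the
   weights other than [l h] sum to 0, and the total weight is 0. *)
have lh : l h = 0.
  suff S0 : \sum_(u | u != h) l u = 0 by move: l0; rewrite (bigD1 h) //= S0 addr0.
  move: (lf0 h); rewrite (bigD1 h) //= ffunE fh (negbTE hI) mulr0 add0r => {2}<-.
  apply: eq_bigr => u uh.
  have [uI|uI] := boolP (u \in I); first by rewrite fI // ffunE !inE eqxx mulr1.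
  by rewrite out ?mul0r // in_setU1 negb_or uh.
move=> u; have [uS|/out//] := boolP (u \in h |: I).
move: uS; rewrite in_setU1 => /predU1P[->//|uI].
(* With [l h] and the outside weights gone, only [f u] still contributes to the coordinate of the
   leaf [u]. *)
move: (lf0 u); rewrite (bigD1 u) //= big1 ?addr0 => [|w wu].
  by rewrite ffunE fI // !inE eqxx orbT mulr1.
have [->|wh] := eqVneq w h; first by rewrite lh mul0r.
have [wI|wI] := boolP (w \in I); last by rewrite out ?mul0r // in_setU1 negb_or wh.
rewrite ffunE fI // !inE [u == w]eq_sym (negbTE wu) orbF.
by case: eqP uI hI => [->->|]; rewrite ?mulr0.
Qed.

Lemma no_other_hub_facet :
  ~ (exists v : V, v \notin closed_nbhd e h /\ induces_star e v I) ->
  facet_defining (IUC_polytope e) (star_coef R h I) #|I|%:R.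
Proof.
move=> /no_other_hub_tight_points[p [indp Fp]]; split; first exact: star_valid.
have zeroP : IUC_polytope e (incidence R set0).
  by apply/IUC_in_polytope/independent_IUC => // x y; rewrite inE.
(* Adjoining the origin, which the face misses, serves twice: it gives the polytope full dimension
   and bounds families in the face by [#|V|]. *)
have extend m (p' : 'I_m -> {ffun V -> R}) : affinely_independent p' ->
    (forall i, face (IUC_polytope e) (star_coef R h I) #|I|%:R (p' i)) ->
  exists p1 : 'I_m.+1 -> {ffun V -> R}, affinely_independent p1 /\
    forall i, IUC_polytope e (p1 i).
  move=> indp' Fp'.
  apply: (affinely_independentS (a := star_coef R h I) (b := #|I|%:R)
    (q := incidence R set0) indp' _ zeroP) => [i|i|].
  - by have [] := Fp' i.
  - by have [_ ->] := Fp' i.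
  - by rewrite lin_form_incidence0 eq_sym pnatr_eq0 -lt0n ltnW.
exists #|V|%:Z; split.
  exists #|V|.+1; split; first by rewrite intS addrC addKr.
    exact: extend indp Fp.
  by move=> m p' indp' _; apply: leq_affinely_independent indp'.
exists #|V|; split=> //; first by exists p.
by move=> m p' indp' /(extend _ _ indp')[p1 [/leq_affinely_independent]].
Qed.

End StarInequality.

(** * Validity, the facet of the star subgraph, and the characterization for the whole graph *)

Theorem theorem8 (R : realFieldType) (V : finType) (e : rel V)
  (e_sym : symmetric e) (e_irr : irreflexive e)
  (h : V) (I : {set V}) (hI : h \notin I) (I_ge2 : (2 <= #|I|)%N)
  (starS : induces_star e h I) :
  [/\ forall x : {ffun V -> R}, IUC_polytope e x ->
        \sum_(i in I) x i + (#|I|%:R - 1) * x h <= #|I|%:R,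
      facet_defining (IUC_polytope (induced e (h |: I)))
        (fun u => star_coef R h I (val u)) #|I|%:R
    & facet_defining (IUC_polytope e) (star_coef R h I) #|I|%:R <->
      ~ (exists v : V, v \notin closed_nbhd e h /\ induces_star e v I)].
Proof.
split.
- by move=> x Px; rewrite -lin_form_star //; apply: star_valid Px.
- have [adjh indI] := starS.
  (* The hub and leaves are transported to the subtype, so that the sufficiency criterion applies to
     the induced star itself. *)
  pose h' : {v : V | v \in h |: I} := exist _ h (setU11 h I).
  pose I' : {set {v : V | v \in h |: I}} := [set u | val u \in I].
  have valI : val @: I' = I.
    apply/setP=> i; apply/imsetP/idP=> [[u] + ->|iI]; first by rewrite inE.
    by exists (exist _ i (setU1r h iI)); rewrite ?inE.
  have cardI : #|I'| = #|I| by rewrite -(card_imset (mem I') val_inj) valI.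
  rewrite -cardI; apply: (@eq_facet_defining _ _ _ (star_coef R h' I')).
    by move=> u; rewrite /star_coef cardI inE.
  apply: no_other_hub_facet; rewrite ?cardI ?inE //.
  + by move=> x y; apply: e_sym.
  + by move=> x; apply: e_irr.
  + by split=> [i|x y]; rewrite !inE; [apply: adjh | apply: indI].
  (* Inside the star every vertex is [h] or a neighbour of [h], so no second hub can exist. *)
  + case=> v [+ _]; rewrite !inE negb_or => /andP[vh' /negP[]] /=.
    have := valP v; rewrite in_setU1 => /predU1P[vh|/adjh//].
    by rewrite -val_eqE /= vh eqxx in vh'.
- by split; [apply: facet_no_other_hub | apply: no_other_hub_facet].
Qed.
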